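(* Let $f_1,\dots,f_m:\mathbb R^d\to[0,\infty)$ be differentiable, let $r_1,\dots,r_m>0$, and for $\theta$ with $r_i-f_i(\theta)>0$ for all $i$ let $$\Phi(\theta)=-\sum_{i=1}^m\log(r_i-f_i(\theta)),\qquad c(\theta)=\sum_{i=1}^m\frac1{r_i-f_i(\theta)},\qquad c_{\min}=\sum_{i=1}^m\frac1{r_i}.$$ Define the Pareto-stationarity residual $\mathcal P(\theta):=\min_{\lambda\in\Delta_m}\big\|\sum_{i=1}^m\lambda_i\nabla f_i(\theta)\big\|$. Then for every $\theta$ with all $r_i-f_i(\theta)>0$, $$\mathcal P(\theta)\le\frac{\|\nabla\Phi(\theta)\|}{c(\theta)}\le\frac{\|\nabla\Phi(\theta)\|}{c_{\min}}.$$ Consequently, for the FedHV global iterates $\theta^0,\dots,\theta^{T-1}$ on a fixed horizon $T\ge1$, $$\frac1T\sum_{t=0}^{T-1}\mathbb E\big[\mathcal P(\theta^t)^2\big]\le\frac1{c_{\min}^2T}\sum_{t=0}^{T-1}\mathbb E\big[\|\nabla\Phi(\theta^t)\|^2\big],$$ and therefore $$\min_{0\le t<T}\mathbb E\,\mathcal P(\theta^t)^2\le\frac1{c_{\min}^2}\min_{0\le t<T}\mathbb E\|\nabla\Phi(\theta^t)\|^2 .$$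
   Context: $\Delta_m=\{\lambda\in\mathbb R_{\ge0}^m:\sum_i\lambda_i=1\}$. FedHV is a randomized federated algorithm producing random global models $\theta^0,\dots,\theta^{T-1}\in\mathbb R^d$; for this statement the only standing property used about them is that almost surely $r_i-f_i(\theta^t)\ge\rho$ for all $i$ and all $t<T$, where $\rho>0$ is a fixed constant. The functions $f_i$ are the nonnegative smooth global task objectives and $r_i$ the fixed reference losses. *)

(* Defs.v *)
From HB Require Import structures.
From mathcomp Require Import all_boot all_order all_algebra.
From mathcomp Require Import all_classical all_reals all_analysis.
Set Implicit Arguments.
Unset Strict Implicit.
Unset Printing Implicit Defensive.
Import Order.TTheory GRing.Theory Num.Theory.
Import numFieldNormedType.Exports.
Local Open Scope classical_set_scope.
Local Open Scope ring_scope.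

(* The library norm `|v| on 'rV[R]_d is the sup norm; here ||.|| is the
   Euclidean one. *)
Definition eucl_norm (R : realType) (d : nat) (v : 'rV[R]_d) : R :=
  Num.sqrt (\sum_(j < d) v ord0 j ^+ 2).

Definition gradient (R : realType) (d : nat) (g : 'rV[R]_d -> R)
    (x : 'rV[R]_d) : 'rV[R]_d :=
  \row_(j < d) 'D_(delta_mx ord0 j) g x.

Definition simplex (R : realType) (m : nat) : set 'rV[R]_m :=
  [set l | (forall i, 0 <= l ord0 i) /\ \sum_(i < m) l ord0 i = 1].

(* A total function, meaningful where all r i - f i x are positive
   (ln is 0 on nonpositive reals). *)
Definition Phi (R : realType) (d m : nat) (f : 'I_m -> 'rV[R]_d -> R)
    (r : 'I_m -> R) (x : 'rV[R]_d) : R :=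
  - \sum_(i < m) ln (r i - f i x).

Definition weight (R : realType) (d m : nat) (f : 'I_m -> 'rV[R]_d -> R)
    (r : 'I_m -> R) (x : 'rV[R]_d) : R :=
  \sum_(i < m) (r i - f i x)^-1.

Definition weight_min (R : realType) (m : nat) (r : 'I_m -> R) : R :=
  \sum_(i < m) (r i)^-1.

(* For m > 0 this infimum is a minimum: see pareto_residual_attained and
   pareto_residual_le below. *)
Definition pareto_residual (R : realType) (d m : nat)
    (f : 'I_m -> 'rV[R]_d -> R) (x : 'rV[R]_d) : R :=
  inf [set eucl_norm (\sum_(i < m) l ord0 i *: gradient (f i) x)
      | l in @simplex R m].

(* Measurability with respect to the Borel sigma-algebra of R^d. *)
Definition random_vector (R : realType) (d : nat) (disp : measure_display)
    (Omega : measurableType disp) (X : Omega -> 'rV[R]_d) : Prop :=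
  measurable_fun [set: Omega]
    (X : Omega -> g_sigma_algebraType (@open 'rV[R]_d)).

Lemma pareto_residual_le (R : realType) (d m : nat)
    (f : 'I_m -> 'rV[R]_d -> R) (x : 'rV[R]_d) (l : 'rV[R]_m) :
  simplex l ->
  pareto_residual f x <= eucl_norm (\sum_(i < m) l ord0 i *: gradient (f i) x).
Proof.
move=> ls; apply: ge_inf; last by exists l.
by exists 0 => _ [l' _ <-]; exact: sqrtr_ge0.
Qed.

Lemma sum_continuous (R : realType) (T : topologicalType) (n : nat)
    (g : 'I_n -> T -> R) :
  (forall i, continuous (g i)) -> continuous (fun x => \sum_(i < n) g i x).
Proof.
move=> cg; elim: n g cg => [|n ih] g cg x.
  under eq_fun do rewrite big_ord0.
  exact: cst_continuous.
under eq_fun do rewrite big_ord_recr /=.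
by apply: cvgD; [apply: (ih (fun i => g (widen_ord (leqnSn n) i)))|exact: cg].
Qed.

Lemma simplex_compact (R : realType) (m : nat) : compact (@simplex R m).
Proof.
apply: bounded_closed_compact.
  exists 1; split; first exact: num_real.
  move=> M M1 l [l0 l1]; rewrite /Num.norm /= mx_normrE.
  apply: bigmax_le => [|[a i] _ /=]; first exact: (le_trans ler01 (ltW M1)).
  rewrite (ord1 a) ger0_norm//; apply: le_trans (ltW M1).
  by rewrite -l1 (bigD1 i)//= lerDl sumr_ge0.
have -> : @simplex R m =
    (\bigcap_(i : 'I_m) ((fun l : 'rV[R]_m => l ord0 i) @^-1` [set z | 0 <= z]))
    `&` (fun l : 'rV[R]_m => \sum_(i < m) l ord0 i) @^-1` [set z | z = 1].
  apply/seteqP; split => l [h1 h2]; split => // i; [by move=> _; exact: h1|].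
  exact: h1.
apply: closedI.
  apply: closed_bigI => i _; apply: preimage_closed; last exact: closed_ge.
  by move=> l _; exact: coord_continuous.
apply: preimage_closed; last exact: closed_eq.
by move=> l _; apply: sum_continuous => i; exact: coord_continuous.
Qed.

Lemma pareto_residual_attained (R : realType) (d m : nat)
    (f : 'I_m -> 'rV[R]_d -> R) (x : 'rV[R]_d) : (0 < m)%N ->
  exists2 l : 'rV[R]_m, simplex l &
  eucl_norm (\sum_(i < m) l ord0 i *: gradient (f i) x) = pareto_residual f x.
Proof.
move=> m0.
pose F (l : 'rV[R]_m) := eucl_norm (\sum_(i < m) l ord0 i *: gradient (f i) x).
have s0 : @simplex R m !=set0.
  exists (delta_mx ord0 (Ordinal m0)); split => [i|].
    by rewrite mxE ler0n.
  rewrite (bigD1 (Ordinal m0))//= mxE !eqxx big1 ?addr0// => i /negPf ni.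
  by rewrite mxE ni andbF.
have cF : continuous F.
  have -> : F = Num.sqrt \o (fun l : 'rV[R]_m => \sum_(j < d)
       (\sum_(i < m) l ord0 i * gradient (f i) x ord0 j) ^+ 2).
    apply/funext => l; rewrite /F /eucl_norm /=; congr Num.sqrt.
    apply: eq_bigr => j _; rewrite summxE; congr (_ ^+ 2).
    by apply: eq_bigr => i _; rewrite [LHS]mxE.
  move=> l; apply: continuous_comp; last exact: sqrt_continuous.
  apply: sum_continuous => j {}l.
  apply: (@continuous_comp _ _ _
    (fun l : 'rV[R]_m => \sum_(i < m) l ord0 i * gradient (f i) x ord0 j)
    (fun z : R => z ^+ 2)); last exact: exprn_continuous.
  apply: sum_continuous => i {}l; apply: cvgMr_tmp;
  [exact: nbhs_filter|exact: coord_continuous].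
have [l] := compact_EVT_min s0 (@simplex_compact R m)
              (continuous_subspaceT cF).
rewrite inE => ls lmin; exists l => //; apply/le_anti/andP; split.
  apply: lb_le_inf; first by case: s0 => k ks; exists (F k); exists k.
  by move=> _ [k ks <-]; apply: lmin; rewrite inE.
exact: pareto_residual_le.
Qed.

(* Main.v *)
(* The chain rule gives grad Phi = sum_i (r i - f i)^-1 grad f i, so dividing by
   c = weight f r exhibits grad Phi / c as a convex combination of the grad f i,
   and f i >= 0 gives c >= weight_min r. Squaring and integrating this pointwise
   bound yields the statements on expectations. Neither integrand is known to be
   measurable, so the almost sure bound is integrated through the definition of
   the integral of a nonnegative function as a supremum over simple functions. *)
Require Import Defs.
From HB Require Import structures.
From mathcomp Require Import all_boot all_order all_algebra.
From mathcomp Require Import all_classical all_reals all_analysis.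
From mathcomp Require Import measurable_realfun.
Import Order.TTheory GRing.Theory Num.Theory.
Import numFieldNormedType.Exports.
Import HBNNSimple.
Local Open Scope classical_set_scope.
Local Open Scope ring_scope.

Lemma ge0_ae_le_integralZl (d : measure_display) (T : measurableType d)
    (R : realType) (mu : {measure set T -> \bar R}) (f g : T -> R) (k : R) :
  0 < k -> (forall x, 0 <= f x) -> (forall x, 0 <= g x) ->
  (\forall x \ae mu, f x <= k * g x) ->
  (\int[mu]_x (f x)%:E <= k%:E * \int[mu]_x (g x)%:E)%E.
Proof.
move=> k0 f0 g0 [N [mN N0 fgN]].
rewrite !ge0_integralTE => [|x|x]; [|exact: g0|exact: f0].
apply: ge_ereal_sup => _ [h hf <-].
(* A simple function below f, cut off on the null set N, is below k * g. *)
pose h1 := proj_nnsfun h (measurableC mN).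
have kV0 : 0 <= k^-1 by rewrite invr_ge0 ltW.
(* The two simple functions differ only on the null set [N], so their integrals agree. *)
have -> : sintegral mu h = sintegral mu h1.
  rewrite -!integralT_nnsfun; apply: ge0_ae_eq_integral => //.
  - exact/measurable_EFinP.
  - exact/measurable_EFinP.
  - by move=> x _; rewrite lee_fin.
  - by move=> x _; rewrite lee_fin.
  exists N; split => // x /= hh1; apply: contra_notP hh1 => Nx _.
  by rewrite /= mindicE mem_set// mulr1.
(* Since [k] is positive, [k^-1 * h1] is again a nonnegative simple function, the competitor in the
   supremum that defines the integral of [g]. *)
have -> : sintegral mu h1 = (k%:E * sintegral mu (scale_nnsfun h1 kV0))%E.
  rewrite -sintegralrM; apply: eq_sintegral => x /=.
  by rewrite mulVKf// gt_eqF.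
apply: lee_wpmul2l; first by rewrite lee_fin ltW.
apply: ereal_sup_ubound; exists (scale_nnsfun h1 kV0) => // x /=.
rewrite lee_fin ler_pdivrMl// mindicE.
(* On [N] the cut-off function vanishes and [0 <= k * g x] suffices; off [N] the bound is
   [h x <= f x <= k * g x]. *)
have [xN|xN] := boolP (x \in ~` N); last by rewrite mulr0 mulr_ge0// ltW.
rewrite mulr1; apply: le_trans (_ : f x <= _); first by rewrite -lee_fin.
by apply: contrapT => /fgN; move: xN; rewrite inE.
Qed.

Lemma is_derive_ln_comp (R : realType) (V : normedModType R) (g : V -> R)
    (x v : V) : differentiable g x -> 0 < g x ->
  is_derive x v (fun y => ln (g y)) ((g x)^-1 * 'D_v g x).
Proof.
move=> dg g0; have dl := is_derive1_ln g0.
have dln : differentiable (@ln R) (g x) by exact/derivable1_diffP.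
have dc : differentiable (@ln R \o g) x by exact: differentiable_comp.
apply: DeriveDef; first exact: diff_derivable.
(* The chain rule is applied to differentials; [deriveE] translates between these and derivatives
   along [v]. *)
rewrite -/(@ln R \o g) deriveE// diff_comp//= deriveE//.
by rewrite diff1E// derive1E derive_val/= mulrC.
Qed.

Lemma gradient_Phi (R : realType) (d m : nat) (f : 'I_m -> 'rV[R]_d -> R)
    (r : 'I_m -> R) (x : 'rV[R]_d) :
  (forall i, differentiable (f i) x) -> (forall i, 0 < r i - f i x) ->
  gradient (Phi f r) x = \sum_(i < m) (r i - f i x)^-1 *: gradient (f i) x.
Proof.
move=> df rf0; apply/rowP => j; rewrite summxE mxE.
under [RHS]eq_bigr do rewrite !mxE.
set v := delta_mx ord0 j.
have dln i : is_derive x v (fun y => ln (r i - f i y))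
    (- ((r i - f i x)^-1 * 'D_v (f i) x)).
  have dB : differentiable (fun y => r i - f i y) x.
    by apply: differentiableB => //; exact: differentiable_cst.
  have := is_derive_ln_comp _ _ _ _ v dB (rf0 i).
  have -> : 'D_v (fun y => r i - f i y) x = - 'D_v (f i) x.
    rewrite -[LHS]/('D_v (cst (r i) - f i) x) deriveB//.
      by rewrite derive_cst sub0r.
    exact: diff_derivable.
  by rewrite mulrN.
(* Written as a sum of functions, [Phi f r] can be differentiated termwise by [derive_val], which
   picks up [dln]. The sign of [Phi] cancels the one in [dln]. *)
have -> : Phi f r = - \sum_(i < m) (fun y => ln (r i - f i y)).
  by apply/funext => y; rewrite /Phi fctE fct_sumE.
by rewrite derive_val sumrN opprK.
Qed.

Lemma eucl_normZ (R : realType) (d : nat) (a : R) (v : 'rV[R]_d) :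
  0 <= a -> eucl_norm (a *: v) = a * eucl_norm v.
Proof.
move=> a0; rewrite /eucl_norm; under eq_bigr do rewrite mxE exprMn.
by rewrite -mulr_sumr sqrtrM ?sqr_ge0// sqrtr_sqr ger0_norm.
Qed.

Lemma weight_gt0 (R : realType) (d m : nat) (f : 'I_m -> 'rV[R]_d -> R)
    (r : 'I_m -> R) (x : 'rV[R]_d) :
  (0 < m)%N -> (forall i, 0 < r i - f i x) -> 0 < weight f r x.
Proof.
move=> m0 rf0; rewrite /weight (bigD1 (Ordinal m0))//=.
by rewrite ltr_pwDl ?invr_gt0// sumr_ge0// => i _; rewrite invr_ge0 ltW.
Qed.

Lemma weight_min_gt0 (R : realType) (m : nat) (r : 'I_m -> R) :
  (0 < m)%N -> (forall i, 0 < r i) -> 0 < weight_min r.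
Proof.
move=> m0 r0; rewrite /weight_min (bigD1 (Ordinal m0))//=.
by rewrite ltr_pwDl ?invr_gt0// sumr_ge0// => i _; rewrite invr_ge0 ltW.
Qed.

Lemma weight_min_le (R : realType) (d m : nat) (f : 'I_m -> 'rV[R]_d -> R)
    (r : 'I_m -> R) (x : 'rV[R]_d) :
  (forall i, 0 <= f i x) -> (forall i, 0 < r i - f i x) ->
  weight_min r <= weight f r x.
Proof.
move=> f0 rf0; apply: ler_sum => i _.
have rf : r i - f i x <= r i by rewrite gerBl.
by rewrite lef_pV2 ?posrE//; exact: lt_le_trans rf.
Qed.

(** The infimum is attained, so it is itself a norm. The sign allows the pointwise bound to be
    squared. *)
Lemma pareto_residual_ge0 (R : realType) (d m : nat)
    (f : 'I_m -> 'rV[R]_d -> R) (x : 'rV[R]_d) :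
  (0 < m)%N -> 0 <= pareto_residual f x.
Proof.
by move=> m0; have [l _ <-] := pareto_residual_attained f x m0; exact: sqrtr_ge0.
Qed.

Lemma pareto_residual_le_gradient_Phi (R : realType) (d m : nat)
    (f : 'I_m -> 'rV[R]_d -> R) (r : 'I_m -> R) (x : 'rV[R]_d) :
  (0 < m)%N -> (forall i, differentiable (f i) x) ->
  (forall i, 0 < r i - f i x) ->
  pareto_residual f x <= eucl_norm (gradient (Phi f r) x) / weight f r x.
Proof.
move=> m0 df rf0; have c0 := weight_gt0 _ _ _ _ _ _ m0 rf0.
(* The multipliers are the coefficients of [gradient (Phi f r) x], normalised by their sum
   [weight f r x]. *)
pose l : 'rV[R]_m := \row_i ((weight f r x)^-1 * (r i - f i x)^-1).
have ls : simplex l.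
  split=> [i|]; first by rewrite mxE mulr_ge0// invr_ge0 ltW.
  under eq_bigr do rewrite mxE.
  by rewrite -mulr_sumr mulVf// gt_eqF.
apply: le_trans (pareto_residual_le f x ls) _.
rewrite mulrC -eucl_normZ ?invr_ge0 ?(ltW c0)// gradient_Phi// scaler_sumr.
by under eq_bigr do rewrite mxE -scalerA.
Qed.

Theorem corollaryA25 (R : realType) (d m : nat) (m_gt0 : (0 < m)%N)
    (f : 'I_m -> 'rV[R]_d -> R) (r : 'I_m -> R)
    (f_ge0 : forall i (x : 'rV[R]_d), 0 <= f i x)
    (f_diff : forall i (x : 'rV[R]_d), differentiable (f i) x)
    (r_gt0 : forall i, 0 < r i) :
  (forall x : 'rV[R]_d, (forall i, 0 < r i - f i x) ->
     pareto_residual f x <= eucl_norm (gradient (Phi f r) x) / weight f r x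
     /\ eucl_norm (gradient (Phi f r) x) / weight f r x
        <= eucl_norm (gradient (Phi f r) x) / weight_min r)
  /\
  (forall (disp : measure_display) (Omega : measurableType disp)
      (P : probability Omega R) (T : nat) (theta : 'I_T -> Omega -> 'rV[R]_d)
      (rho : R),
     (0 < T)%N -> 0 < rho ->
     (forall t, random_vector (theta t)) ->
     (\forall w \ae P, forall (i : 'I_m) (t : 'I_T),
        rho <= r i - f i (theta t w)) ->
     ((T%:R^-1)%:E *
        (\sum_(t < T) 'E_P[(fun w => pareto_residual f (theta t w) ^+ 2)%R])
      <= ((weight_min r ^+ 2 * T%:R)^-1)%:E *
         (\sum_(t < T)
           'E_P[(fun w => eucl_norm (gradient (Phi f r) (theta t w)) ^+ 2)%R]))%E
     /\
     (\big[Order.min/+oo]_(t < T)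
          'E_P[(fun w => pareto_residual f (theta t w) ^+ 2)%R]
      <= ((weight_min r ^+ 2)^-1)%:E *
         \big[Order.min/+oo]_(t < T)
           'E_P[(fun w => eucl_norm (gradient (Phi f r) (theta t w)) ^+ 2)%R])%E).
Proof.
have cm0 := weight_min_gt0 _ _ _ m_gt0 r_gt0.
have bounds (x : 'rV[R]_d) : (forall i, 0 < r i - f i x) ->
    pareto_residual f x <= eucl_norm (gradient (Phi f r) x) / weight f r x
    /\ eucl_norm (gradient (Phi f r) x) / weight f r x
       <= eucl_norm (gradient (Phi f r) x) / weight_min r.
  move=> rf0; split; first exact: pareto_residual_le_gradient_Phi.
  rewrite ler_wpM2l ?sqrtr_ge0// lef_pV2 ?posrE ?weight_gt0//.
  exact: weight_min_le.
split=> // disp Omega P T theta rho T0 rho0 _ aerho.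
have V0 : 0 < (weight_min r ^+ 2)^-1 by rewrite invr_gt0 exprn_gt0.
(* Both conclusions reduce to this bound for a single iterate. *)
have E_le (t : 'I_T) :
    ('E_P[(fun w => pareto_residual f (theta t w) ^+ 2)%R]
     <= ((weight_min r ^+ 2)^-1)%:E *
        'E_P[(fun w => eucl_norm (gradient (Phi f r) (theta t w)) ^+ 2)%R])%E.
  rewrite unlock; apply: ge0_ae_le_integralZl => //.
  - by move=> w; exact: sqr_ge0.
  - by move=> w; exact: sqr_ge0.
  apply: filterS aerho => w rhow.
  have [le1 le2] : pareto_residual f (theta t w) <= _ /\ _ <= _ :=
    bounds (theta t w) (fun i => lt_le_trans rho0 (rhow i t)).
  (* The right-hand side becomes the square of the norm over [weight_min r], so comparing the
     nonnegative bases is enough. *)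
  rewrite mulrC -exprVn -exprMn lerXn2r ?nnegrE ?pareto_residual_ge0//.
  - by rewrite mulr_ge0 ?sqrtr_ge0// invr_ge0 ltW.
  - exact: le_trans le2.
split.
  rewrite invfM mulrC EFinM -muleA; apply: lee_wpmul2l.
    by rewrite lee_fin invr_ge0.
  rewrite ge0_sume_distrr; first exact: lee_sum.
  by move=> t _; apply: expectation_ge0 => w; exact: sqr_ge0.
(* Induction on the right-hand minimum only: its default [+oo] stays [+oo] under the positive
   factor, a binary minimum is one of its arguments, and the term at [t] dominates the left-hand
   minimum through [E_le t]. *)
elim/big_ind : (X in (_ <= _ * X)%E) => [|a b la lb|t _].
- by rewrite gt0_muley ?leey// lte_fin.
- by rewrite minEle; case: ifPn.
- exact: le_trans (bigmin_le _ _ _) (E_le t).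
Qed.
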